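(* Let $\{S_{\mathbf{t}}\subseteq\mathbb{Z}^d : \mathbf{t}\in\mathbb{Z}^k\}$ be a $k$-parametric unordered Presburger arithmetic family. Then: (1) there is an algorithm, running in time polynomial in the binary input size of $\mathbf{t}$, which on input $\mathbf{t}$ decides whether $S_{\mathbf{t}}$ is nonempty; (2) there is an algorithm, running in time polynomial in the binary input size of $\mathbf{t}$, which on input $\mathbf{t}$ decides whether $S_{\mathbf{t}}$ is finite or infinite; (3) there is a function $g:\mathbb{Z}^k\to\mathbb{N}$, computable in time polynomial in the binary input size of $\mathbf{t}$, such that $g(\mathbf{t})=|S_{\mathbf{t}}|$ whenever $S_{\mathbf{t}}$ is finite.
   Context: A $k$-parametric unordered Presburger arithmetic family is a collection $\{S_{\mathbf{t}} : \mathbf{t}=(t_1,\dots,t_k)\in\mathbb{Z}^k\}$ of subsets of $\mathbb{Z}^d$ defined by a fixed formula: $S_{\mathbf{t}} = \{\mathbf{x}\in\mathbb{Z}^d : Q_1y_1\cdots Q_my_m\ \Theta_{\mathbf{t}}(\mathbf{x},\mathbf{y})\}$, where $Q_i\in\{\forall,\exists\}$, the $y_i$ range over $\mathbb{Z}$, and $\Theta_{\mathbf{t}}(\mathbf{x},\mathbf{y})$ is a Boolean combination of linear equations (no inequalities) in $(\mathbf{x},\mathbf{y})$ whose coefficients and constant terms lie in $\mathbb{Z}[\mathbf{t}]$. The input size of $\mathbf{t}$ is $k+\sum_i\log_2|t_i|$. *)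

(* Defs.v *)
From HB Require Import structures.
From mathcomp Require Import all_boot all_order all_algebra.
From mathcomp Require Import finmap classical_sets functions cardinality.
From mathcomp Require Import mpoly.
Set Implicit Arguments.
Unset Strict Implicit.
Unset Printing Implicit Defensive.
Import GRing.Theory.
Local Open Scope classical_set_scope.
Local Open Scope ring_scope.

Section Families.
Variables k d : nat.

(* \sum_i xcoef_i x_i + \sum_j ycoef_j y_j = rhs *)
Record linear_equation (m : nat) := LinearEquation {
  xcoef : 'rV[{mpoly int[k]}]_d;
  ycoef : 'rV[{mpoly int[k]}]_m;
  rhs : {mpoly int[k]}
}.

Inductive boolean_combination (m : nat) :=
| Atom of linear_equation m
| Neg of boolean_combination m
| Conj of boolean_combination m & boolean_combination m
| Disj of boolean_combination m & boolean_combination m.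

Inductive quantifier := Forall | Exists.

(* The head of [prefix] is the outermost quantifier. *)
Record unordered_family := UnorderedFamily {
  prefix : seq quantifier;
  body : boolean_combination (size prefix)
}.

Definition equation_holds m (e : linear_equation m)
    (t : 'rV[int]_k) (x : 'rV[int]_d) (y : 'rV[int]_m) : Prop :=
  \sum_i (xcoef e 0 i).@[t 0] * x 0 i + \sum_j (ycoef e 0 j).@[t 0] * y 0 j
  = (rhs e).@[t 0].

Fixpoint combination_holds m (b : boolean_combination m)
    (t : 'rV[int]_k) (x : 'rV[int]_d) (y : 'rV[int]_m) : Prop :=
  match b with
  | Atom e => equation_holds e t x y
  | Neg b1 => ~ combination_holds b1 t x y
  | Conj b1 b2 => combination_holds b1 t x y /\ combination_holds b2 t x y
  | Disj b1 b2 => combination_holds b1 t x y \/ combination_holds b2 t x y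
  end.

Fixpoint quantify (Q : seq quantifier) :
    ('rV[int]_(size Q) -> Prop) -> Prop :=
  match Q return ('rV[int]_(size Q) -> Prop) -> Prop with
  | [::] => fun P => P 0
  | Forall :: Q' => fun P =>
      forall y1 : int, quantify (fun y => P (row_mx y1%:M y))
  | Exists :: Q' => fun P =>
      exists y1 : int, quantify (fun y => P (row_mx y1%:M y))
  end.

Definition member (F : unordered_family) (t : 'rV[int]_k) : set 'rV[int]_d :=
  [set x | quantify (combination_holds (body F) t x)].

End Families.

(* While programs over integer registers with logarithmic cost: a step is
   charged for the bit lengths of its operands. Arithmetic is charged their
   product, which bounds schoolbook arithmetic up to a constant factor and
   dominates the growth of the registers, so polynomial cost is polynomial
   time on a Turing machine. *)
Inductive binop := Add | Sub | Mul | Div.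

Inductive program :=
| Const of nat & int
| Op of binop & nat & nat & nat
| Seq of program & program
| IfPos of nat & program & program
| WhilePos of nat & program.

Definition state := nat -> int.

Definition update (s : state) (r : nat) (v : int) : state :=
  fun i => if i == r then v else s i.

(* [divz] is total, with (a %/ 0)%Z = 0. *)
Definition eval_op (o : binop) (a b : int) : int :=
  match o with
  | Add => a + b
  | Sub => a - b
  | Mul => a * b
  | Div => (a %/ b)%Z
  end.

(* floor (log_2 |a|), and 0 when a = 0 *)
Definition log2z (a : int) : nat := trunc_log 2 `|a|%N.

Definition bit_length (a : int) : nat := (log2z a).+1.

(* [exec c s n s']: started in s, the program c halts in s' at total cost n. *)
Inductive exec : program -> state -> nat -> state -> Prop :=
| ExecConst r v (s : state) : exec (Const r v) s (bit_length v) (update s r v)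
| ExecOp o r a b (s : state) :
    exec (Op o r a b) s (bit_length (s a) * bit_length (s b))%N
      (update s r (eval_op o (s a) (s b)))
| ExecSeq c1 c2 s1 s2 s3 n1 n2 :
    exec c1 s1 n1 s2 -> exec c2 s2 n2 s3 -> exec (Seq c1 c2) s1 (n1 + n2)%N s3
| ExecIfTrue r c1 c2 (s : state) n s' : 0 < s r ->
    exec c1 s n s' -> exec (IfPos r c1 c2) s (bit_length (s r) + n)%N s'
| ExecIfFalse r c1 c2 (s : state) n s' : s r <= 0 ->
    exec c2 s n s' -> exec (IfPos r c1 c2) s (bit_length (s r) + n)%N s'
| ExecWhileTrue r c (s1 s2 s3 : state) n1 n2 : 0 < s1 r ->
    exec c s1 n1 s2 -> exec (WhilePos r c) s2 n2 s3 ->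
    exec (WhilePos r c) s1 (bit_length (s1 r) + n1 + n2)%N s3
| ExecWhileFalse r c (s : state) : s r <= 0 ->
    exec (WhilePos r c) s (bit_length (s r)) s.

Section PolynomialTime.
Variable k : nat.

(* Registers 0, ..., k-1 hold the input; all others hold 0. *)
Definition input_state (t : 'rV[int]_k) : state :=
  fun r => if insub r is Some i then t 0 i else 0.

(* k + sum_i log_2 |t_i|, with logarithms rounded down and log_2 0 read as 0. *)
Definition input_size (t : 'rV[int]_k) : nat := (k + \sum_i log2z (t 0%R i))%N.

(* The output is read in register 0. *)
Definition polytime_computable (f : 'rV[int]_k -> int) : Prop :=
  exists (c : program) (p : {poly nat}), forall t : 'rV[int]_k,
    exists (n : nat) (s : state),
      [/\ exec c (input_state t) n s, s 0%N = f t & (n <= p.[input_size t])%N].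

Definition polytime_decidable (P : 'rV[int]_k -> Prop) : Prop :=
  exists f : 'rV[int]_k -> bool,
    polytime_computable (fun t => (f t)%:Z) /\ forall t, f t <-> P t.

End PolynomialTime.

(* Main.v *)
(* Unlike the ordered case, everything can be computed with a bounded number of
   additions, multiplications, divisions and extended gcds of integers of
   polynomial bit length, along a scheme that depends on the formula but not on
   t. Formulas are Boolean combinations of congruences (with modulus 0 for
   equations) whose coefficients are such expressions in t, and they admit
   quantifier elimination: in disjunctive normal form, Bezout coefficients of a
   positive congruence in the eliminated variable y parametrize its solutions by
   a free variable, and substituting them removes that congruence. When only
   negated congruences remain, y has to avoid N cosets (or points), and there is
   a constant B(N) such that N cosets covering B(N) consecutive integers cover
   all of Z; so it suffices to test y = 0, ..., B(N) - 1.
   A set of integers defined by such a formula differs from a periodic set, the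
   one obtained by replacing the nontrivial equations by false, only at the
   solutions of these equations. Hence it is finite iff the periodic set is
   empty, and then it is contained in a list of solutions whose length does not
   depend on t. Applied to the coordinate projections of S_t, this decides
   finiteness, and confines a finite S_t to an explicit grid of bounded size,
   whose members are counted one by one. *)
Require Import Defs.
From mathcomp Require Import all_boot all_order all_algebra.
From mathcomp Require Import finmap classical_sets functions cardinality.
From mathcomp Require Import mpoly zify ring.
Set Implicit Arguments.
Unset Strict Implicit.
Unset Printing Implicit Defensive.
Import Order.TTheory GRing.Theory Num.Theory.
Local Open Scope classical_set_scope.
Local Open Scope card_scope.
Local Open Scope ring_scope.

(** * Bit lengths *)

Lemma bit_length_gt0 v : (0 < bit_length v)%N. Proof. by []. Qed.

Lemma absz_lt_bit_length v : (`|v|%N < 2 ^ bit_length v)%N.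
Proof. by rewrite /bit_length /log2z trunc_log_ltn. Qed.

Lemma bit_length_le v K : (0 < K)%N -> (`|v|%N < 2 ^ K)%N ->
  (bit_length v <= K)%N.
Proof.
move=> K0 vK; rewrite /bit_length /log2z.
have [->|v0] := posnP `|v|%N; first by rewrite trunc_log0.
rewrite -(ltn_exp2l _ _ (isT : 1 < 2)%N).
have /andP[] := @trunc_log_bounds 2 _ isT v0; lia.
Qed.

Lemma bit_length_monotone u v : (`|u| <= `|v|)%N ->
  (bit_length u <= bit_length v)%N.
Proof.
by move=> uv; apply: bit_length_le => //; rewrite (leq_ltn_trans uv) ?absz_lt_bit_length.
Qed.

Lemma bit_length_eval_op o a b :
  (bit_length (eval_op o a b) <= bit_length a + bit_length b)%N.
Proof.
have A := absz_lt_bit_length a; have B := absz_lt_bit_length b.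
have A0 := bit_length_gt0 a; have B0 := bit_length_gt0 b.
(* Both powers of 2 are at least 2, so their sum is at most their product. *)
have S : (`|a|%N + `|b|%N < 2 ^ (bit_length a + bit_length b))%N.
  rewrite expnD.
  have : (2 ^ 1 <= 2 ^ bit_length a)%N by rewrite leq_exp2l.
  have : (2 ^ 1 <= 2 ^ bit_length b)%N by rewrite leq_exp2l.
  by rewrite expn1; nia.
apply: bit_length_le; first lia.
case: o => /=; [lia|lia| |].
  by rewrite abszM expnD; nia.
by have := lez_div a b; lia.
Qed.

(** * Hoare triples on register windows *)

(* [l] lists the contents of the registers r, r+1, ...; below r the state is
   still the initial state [s0]. *)
Definition window (s0 : state) r (l : seq int) (s : state) :=
  (forall i, (i < r)%N -> s i = s0 i) /\
  (forall j, (j < size l)%N -> s (r + j)%N = l`_j).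

(** Total correctness at cost at most [C]. The contents are listed as actual values, so executing a
    program amounts to rewriting a list. *)
Definition triple r l c C l' := forall s0 s, window s0 r l s ->
  exists n s', [/\ exec c s n s', (n <= C)%N & window s0 r l' s'].

Definition offset_op r o j a b := Op o (r + j)%N (r + a)%N (r + b)%N.

Lemma window_update s0 r l s j v : window s0 r l s -> (j < size l)%N ->
  window s0 r (set_nth 0 l j v) (update s (r + j)%N v).
Proof.
move=> [lo hi] jl; split=> [i ir|i].
  by rewrite /update ltn_eqF ?lo // (leq_trans ir) ?leq_addr.
rewrite size_set_nth => il; rewrite /update eqn_add2l nth_set_nth /=.
by case: eqP => // _; rewrite hi //; move: il jl; rewrite /maxn; case: ifP; lia.
Qed.

Lemma triple_op K r l o j a b :
  (j < size l)%N -> (a < size l)%N -> (b < size l)%N ->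
  (bit_length l`_a <= K)%N -> (bit_length l`_b <= K)%N ->
  triple r l (offset_op r o j a b) (K * K)
    (set_nth 0 l j (eval_op o l`_a l`_b)).
Proof.
move=> jl al bl aK bK s0 s W; have [_ hi] := W.
do 2 eexists; split; [exact: ExecOp | |]; rewrite !hi //; first exact: leq_mul.
exact: window_update.
Qed.

Lemma triple_const r l j v : (j < size l)%N ->
  triple r l (Const (r + j) v) (bit_length v) (set_nth 0 l j v).
Proof.
move=> jl s0 s W; do 2 eexists; split; [exact: ExecConst | exact: leqnn |].
exact: window_update.
Qed.

Lemma triple_seq r l l1 l2 c1 c2 C1 C2 : triple r l c1 C1 l1 ->
  triple r l1 c2 C2 l2 -> triple r l (Seq c1 c2) (C1 + C2) l2.
Proof.
move=> H1 H2 s0 s /H1 [n1 [s1 [E1 N1 /H2 [n2 [s2 [E2 N2 W]]]]]].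
by exists (n1 + n2)%N, s2; split=> //; [exact: ExecSeq E1 E2 | exact: leq_add].
Qed.

Lemma triple_if r l l' j c1 c2 C : (j < size l)%N ->
  triple r l (if 0 < l`_j then c1 else c2) C l' ->
  triple r l (IfPos (r + j) c1 c2) (bit_length l`_j + C) l'.
Proof.
move=> jl H s0 s W; have [_ /(_ _ jl) hi] := W.
have [n [s' [E N W']]] := H _ _ W; exists (bit_length (s (r + j)%N) + n)%N, s'.
split=> //; last by rewrite hi leq_add2l.
by move: E; case: ifP => lj E; [apply: ExecIfTrue | apply: ExecIfFalse];
  rewrite ?hi // leNgt lj.
Qed.

Lemma triple_while_true r l l1 l2 j c C1 C2 : (j < size l)%N -> 0 < l`_j ->
  triple r l c C1 l1 -> triple r l1 (WhilePos (r + j) c) C2 l2 ->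
  triple r l (WhilePos (r + j) c) (bit_length l`_j + C1 + C2) l2.
Proof.
move=> jl l0 H1 H2 s0 s W; have [_ /(_ _ jl) hi] := W.
move: (W) => /H1 [n1 [s1 [E1 N1 /H2 [n2 [s2 [E2 N2 W']]]]]].
exists (bit_length (s (r + j)%N) + n1 + n2)%N, s2; split=> //.
  by apply: ExecWhileTrue E1 E2; rewrite hi.
by rewrite hi !leq_add.
Qed.

Lemma triple_while_false r l j c : (j < size l)%N -> l`_j <= 0 ->
  triple r l (WhilePos (r + j) c) (bit_length l`_j) l.
Proof.
move=> jl l0 s0 s W; have [_ /(_ _ jl) hi] := W.
exists (bit_length (s (r + j)%N)), s; split; rewrite ?hi //.
by rewrite -hi; apply: ExecWhileFalse; rewrite hi.
Qed.

Lemma triple_weaken r l c C C' l' : (C <= C')%N ->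
  triple r l c C l' -> triple r l c C' l'.
Proof.
move=> CC H s0 s /H [n [s' [E N W]]]; exists n, s'; split=> //.
exact: leq_trans CC.
Qed.

Lemma triple_eq r l c C l1 l2 : triple r l c C l1 -> l1 = l2 ->
  triple r l c C l2.
Proof. by move=> ? <-. Qed.

(** * The extended Euclidean algorithm *)

(** Euclid's algorithm with fuel [N], tracking the coefficient of one argument only and reducing it
    modulo [m] to keep it small. The other coefficient is recovered afterwards from a
    divisibility. *)
Fixpoint bezout_loop N (m a b x0 x1 : int) : int * int :=
  if N is N'.+1 then
    if 0 < b then
      bezout_loop N' m b (a - (a %/ b)%Z * b) x1 ((x0 - (a %/ b)%Z * x1) %% m)%Z
    else (a, x0)
  else (a, x0).

(** The fuel suffices because the initial product [m * (b %% m)] is at most [m * m] and is halved in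
    each round. The last branch serves [m = 0], where [b] itself is a gcd with coefficient 1. *)
Definition bezout (b m : int) : int * int :=
  if 0 < m then bezout_loop (bit_length (m * m)) m m (b %% m)%Z 0 1
  else (b, 1).

(** A quotient of at least 1 gives [a >= b + b' > 2 * b']. So the product of consecutive remainders
    is halved, and the number of rounds is linear in the bit length. *)
Lemma bezout_measure N (a b : int) : 0 < b -> b < a -> a * b < (2 ^ N.+1)%:Z ->
  let b' := a - (a %/ b)%Z * b in [/\ 0 <= b', b' < b & b * b' < (2 ^ N)%:Z].
Proof.
move=> b0 ba abN /=; have E := divz_eq a b.
have r0 : 0 <= (a %% b)%Z by apply: modz_ge0; lia.
have rb := ltz_pmod a b0.
have -> : a - (a %/ b)%Z * b = (a %% b)%Z by [].
have q1 : 1 <= (a %/ b)%Z by nia.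
split=> //; move: abN; rewrite expnS PoszM; nia.
Qed.

Lemma bezout_loop_bound N m a b x0 x1 : 0 < m -> 0 <= b -> b < a -> a <= m ->
  0 <= x0 <= m -> 0 <= x1 <= m -> a * b < (2 ^ N)%:Z ->
  let: (g, x) := bezout_loop N m a b x0 x1 in
  [/\ 0 <= g <= m & 0 <= x <= m].
Proof.
elim: N a b x0 x1 => [|N IH] a b x0 x1 m0 b0 ba am X0 X1 abN /=.
  by split=> //; lia.
case: ltP => b1; last by split=> //; lia.
have [b'0 b'b bN] := bezout_measure b1 ba abN.
by apply: IH => //; lia.
Qed.

Lemma bezout_loop_divides N m a b x0 x1 : 0 < m -> 0 <= b -> b < a ->
  a * b < (2 ^ N)%:Z ->
  ((bezout_loop N m a b x0 x1).1 %| a)%Z /\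
  ((bezout_loop N m a b x0 x1).1 %| b)%Z.
Proof.
elim: N a b x0 x1 => [|N IH] a b x0 x1 m0 b0 ba abN /=.
  (* Fuel runs out only when [a * b < 1], which with [0 <= b < a] forces [b = 0]. *)
  have -> : b = 0 by move: abN; rewrite expn0; nia.
  by rewrite dvdzz dvdz0.
case: ltP => b1; last first.
  have -> : b = 0 by lia.
  by rewrite dvdzz dvdz0.
have [b'0 b'b bN] := bezout_measure b1 ba abN.
have [gb gr] :=
  IH _ _ x1 ((x0 - (a %/ b)%Z * x1) %% m)%Z m0 b'0 b'b bN.
split=> //.
rewrite -[X in (_ %| X)%Z](subrK ((a %/ b)%Z * b)).
by apply: rpredD => //; apply: dvdz_mull.
Qed.

(** Loop invariant: modulo [m], [a] is [x0 * c] and [b] is [x1 * c]. Reducing the coefficients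
    modulo [m] preserves it. *)
Lemma bezout_loop_combination c N (m a b x0 x1 : int) :
  (m %| a - x0 * c)%Z -> (m %| b - x1 * c)%Z ->
  let: (g, x) := bezout_loop N m a b x0 x1 in (m %| g - x * c)%Z.
Proof.
elim: N a b x0 x1 => //= N IH a b x0 x1 A B; case: ifP => // _.
apply: IH => //; set q := (a %/ b)%Z.
rewrite /modz; set u := (_ %/ m)%Z.
have -> : a - q * b - (x0 - q * x1 - u * m) * c =
  (a - x0 * c) - q * (b - x1 * c) + u * c * m by ring.
apply: rpredD; last exact: dvdz_mull.
by apply: rpredB => //; apply: dvdz_mull.
Qed.

Lemma bezoutP b m : 0 <= m -> let: (g, x) := bezout b m in
  [/\ (g %| b)%Z, (g %| m)%Z & exists y, g = x * b + y * m].
Proof.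
rewrite le_eqVlt /bezout => /predU1P[<-|m0].
  by rewrite ltxx; split; rewrite ?dvdz0 //; exists 0; rewrite mul1r mul0r addr0.
rewrite m0; set N := bit_length _.
have r0 : 0 <= (b %% m)%Z by apply: modz_ge0; lia.
have rm := ltz_pmod b m0.
have mN : m * (b %% m)%Z < (2 ^ N)%:Z.
  have := absz_lt_bit_length (m * m); rewrite -/N.
  have : m * (b %% m)%Z <= m * m by nia.
  have : 0 <= m * m by nia.
  lia.
have [gm gb] := @bezout_loop_divides N m m (b %% m)%Z 0 1 m0 r0 rm mN.
have := @bezout_loop_combination b N m m (b %% m)%Z 0 1.
case: bezout_loop gm gb => g x /= gm gb H; split=> //.
  by rewrite [X in (_ %| X)%Z](divz_eq b m); apply: rpredD => //; apply: dvdz_mull.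
have /dvdzP[y E] : (m %| g - x * b)%Z.
  apply: H; first by rewrite mul0r subr0 dvdzz.
  rewrite mul1r /modz addrAC subrr add0r.
  by apply: rpredNr; apply: dvdz_mull.
by exists y; rewrite -E; ring.
Qed.

(** One round of Euclid. Copying is addition of the register that holds 0, and a remainder is
    obtained by a division, a multiplication and a subtraction. *)
Definition bezout_body r :=
  Seq (offset_op r Div 5 2 0) (Seq (offset_op r Mul 6 5 0)
  (Seq (offset_op r Defs.Sub 6 2 6) (Seq (offset_op r Add 2 0 7)
  (Seq (offset_op r Add 0 6 7) (Seq (offset_op r Mul 6 5 4)
  (Seq (offset_op r Defs.Sub 6 3 6) (Seq (offset_op r Add 3 4 7)
  (Seq (offset_op r Div 4 6 1) (Seq (offset_op r Mul 4 4 1)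
  (offset_op r Defs.Sub 4 6 4)))))))))).

(* Registers r, ..., r+7 hold b, m, a, x0, x1, the quotient, a scratch value
   and 0. *)
Definition bezout_program (first : bool) r :=
  Seq (Const (r + 7) 0)
  (Seq (IfPos (r + 1)
         (Seq (offset_op r Div 6 0 1) (Seq (offset_op r Mul 6 6 1)
         (Seq (offset_op r Defs.Sub 0 0 6) (Seq (offset_op r Add 2 1 7)
         (Seq (Const (r + 3) 0) (Seq (Const (r + 4) 1)
         (WhilePos (r + 0) (bezout_body r))))))))
         (Seq (offset_op r Add 2 0 7) (Const (r + 3) 1)))
  (offset_op r Add 0 (if first then 2 else 3) 7)).

(** Quotient and coefficients are at most [m], so their product is at most [m * m], and rounding to
    a multiple of [m] costs at most one more [m]. The quotients are variables here, so that linear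
    arithmetic applies once the products are generalized. *)
Lemma bezout_step_bounds (q b m a x0 x1 v w : int) :
  0 < b -> b < a -> a <= m -> 0 <= x0 <= m -> 0 <= x1 <= m ->
  q * b <= a -> a - q * b < b -> v = x0 - q * x1 ->
  0 <= v - w * m < m -> `|w| <= `|v| ->
  all (fun u => `|u| <= m * m + m)
    [:: a; b; m; 0; x0; x1; q; q * b; a - q * b; q * x1; v; w; w * m].
Proof.
move=> b0 ba am X0 X1 qb1 qb2 vE W wv.
have q0 : 0 <= q by rewrite -ltzD1 -(pmulr_lgt0 _ b0) mulrDl mul1r; lia.
have qb0 : 0 <= q * b by apply: mulr_ge0; lia.
have qa : q <= a by apply: le_trans qb1; apply: ler_peMr; lia.
have qx0 : 0 <= q * x1 by apply: mulr_ge0; lia.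
have qx : q * x1 <= m * m by apply: ler_pM; lia.
have mm : m <= m * m by apply: ler_peMr; lia.
move: (q * b) (q * x1) (w * m) (m * m) qb0 qb1 qb2 qx0 qx mm vE W => *.
by rewrite /= !andbT; do ?(apply/andP; split); lia.
Qed.

Lemma triple_bezout_body K r (b m a x0 x1 q z : int) :
  (0 < K)%N -> m * m + m < (2 ^ K)%:Z -> 0 < b -> b < a -> a <= m ->
  0 <= x0 <= m -> 0 <= x1 <= m ->
  triple r [:: b; m; a; x0; x1; q; z; 0] (bezout_body r) (11 * (K * K))
    [:: a - (a %/ b)%Z * b; m; b; x1; ((x0 - (a %/ b)%Z * x1) %% m)%Z;
        (a %/ b)%Z; x0 - (a %/ b)%Z * x1; 0].
Proof.
move=> K0 mK b0 ba am X0 X1; have m0 : 0 < m by lia.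
have : all (fun u => bit_length u <= K)%N
    (let q := (a %/ b)%Z in let v := x0 - q * x1 in let w := (v %/ m)%Z in
    [:: a; b; m; 0; x0; x1; q; q * b; a - q * b; q * x1; v; w; w * m]).
  apply: sub_all (bezout_step_bounds b0 ba am X0 X1 _ _ erefl _ (lez_div _ _)).
  - by move=> u um; apply: bit_length_le => //; lia.
  - by rewrite lez_floor // gt_eqF.
  - exact: ltz_pmod.
  - by rewrite -/(modz _ m) modz_ge0 ?ltz_pmod // gt_eqF.
move=> /= /and5P[Ha Hb Hm H0 /and5P[Hx0 Hx1 Hq Hqb]].
case/and5P => Hr Hqx Hv Hw; rewrite andbT /modz => Hwm.
rewrite !mulSn mul0n addn0.
do 10 (apply: triple_seq; first
  by apply: (triple_op (K := K)) => //=; rewrite ?addr0).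
by rewrite /= !addr0; apply: triple_op.
Qed.

(** Each round costs at most twelve times [K * K], for eleven operations and the loop test; the
    successor pays for the final test. *)
Lemma triple_bezout_loop K r (m : int) N (b a x0 x1 q z : int) :
  (0 < K)%N -> m * m + m < (2 ^ K)%:Z -> 0 <= b -> b < a -> a <= m ->
  0 <= x0 <= m -> 0 <= x1 <= m -> a * b < (2 ^ N)%:Z ->
  let: (g, x) := bezout_loop N m a b x0 x1 in
  exists b' x' q' z' : int,
  triple r [:: b; m; a; x0; x1; q; z; 0] (WhilePos (r + 0) (bezout_body r))
    ((N * 12).+1 * (K * K)) [:: b'; m; g; x; x'; q'; z'; 0].
Proof.
move=> K0 mK; elim: N b a x0 x1 q z => [|N IH] b a x0 x1 q z b0 ba am X0 X1 abN.
all: have bK : (bit_length b <= K * K)%N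
  by apply: leq_trans (leq_pmulr _ K0); apply: bit_length_le => //; nia.
  exists b, x1, q, z; apply: triple_weaken _ (triple_while_false _ _ _) => //=.
    by rewrite mul1n.
  by move: abN; rewrite expn0; nia.
rewrite /=; case: ltP => b1; last first.
  exists b, x1, q, z; apply: triple_weaken _ (triple_while_false _ _ _) => //=.
  by rewrite (leq_trans bK) ?leq_pmull.
have [b'0 b'b bN] := bezout_measure b1 ba abN.
have := IH _ _ x1 ((x0 - (a %/ b)%Z * x1) %% m)%Z (a %/ b)%Z
  (x0 - (a %/ b)%Z * x1) b'0 b'b _ _ _ bN.
case: bezout_loop => g x [||| b' [x' [q' [z' T]]]]; try lia.
exists b', x', q', z'.
have W := @triple_while_true r [:: b; m; a; x0; x1; q; z; 0] _ _ 0 _ _ _ isT b1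
  (@triple_bezout_body K r b m a x0 x1 q z K0 mK b1 ba am X0 X1) T.
apply: triple_weaken _ W.
by move: (K * K)%N bK => C /=; nia.
Qed.

(** For positive [m] both outputs lie between 0 and [m], the coefficient thanks to its reduction, so
    nested gcds keep a controlled length. *)
Lemma bezout_bound b m : let: (g, x) := bezout b m in
  (bit_length g <= bit_length b + bit_length m)%N /\
  (bit_length x <= bit_length b + bit_length m)%N.
Proof.
rewrite /bezout; case: ltP => m0; last first.
  by split; [exact: leq_addr | exact: leq_trans (bit_length_gt0 b) (leq_addr _ _)].
have r0 : 0 <= (b %% m)%Z by apply: modz_ge0; lia.
have rm := ltz_pmod b m0.
have := @bezout_loop_bound (bit_length (m * m)) m m (b %% m)%Z 0 1.
case: bezout_loop => g x [] //; try lia.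
  have := absz_lt_bit_length (m * m).
  have : m * (b %% m)%Z <= m * m by apply: ler_pM; lia.
  lia.
by move=> ? ?; split; apply: leq_trans (leq_addl _ _);
  apply: bit_length_monotone; lia.
Qed.

Lemma triple_bezout_program f r (b m : int) l : size l = 6 ->
  let K := (2 * (bit_length b + bit_length m))%N in
  exists l', triple r [:: b, m & l] (bezout_program f r)
    ((K * 12 + 11) * (K * K)) l' /\
    [/\ (0 < size l')%N & l'`_0 = if f then (bezout b m).1 else (bezout b m).2].
Proof.
case: l => [|i0 [|i [|i1 [|i2 [|i3 [|i4 [|? ?]]]]]]] // _ K.
have := bezout_bound b m; rewrite /bezout.
have K2 : (2 <= K)%N by rewrite /K; have := bit_length_gt0 b; lia.
have Kb : (bit_length b <= K)%N by rewrite /K; lia.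
have Km : (bit_length m <= K)%N by rewrite /K; lia.
have K0 : (bit_length 0 <= K)%N by exact: leq_trans K2.
have K1 : (bit_length 1 <= K)%N by exact: leq_trans K2.
have KK : (K <= K * K)%N by nia.
case: ltP => m0 B.
  (* The factor 2 in [K] makes [2 ^ K] at least the square of a power of 2 that exceeds [m]. *)
  have mK : m * m + m < (2 ^ K)%:Z.
    have := absz_lt_bit_length m; set M := (2 ^ bit_length m)%N => mM.
    have : (M * M <= 2 ^ K)%N.
      by rewrite /M -expnD leq_exp2l // /K; lia.
    nia.
  have r0 : 0 <= (b %% m)%Z by apply: modz_ge0; lia.
  have rm := ltz_pmod b m0.
  have small : forall u, `|u| <= m -> (bit_length u <= K)%N.
    by move=> u um; apply: leq_trans Km; apply: bit_length_monotone; lia.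
  have mmN : m * (b %% m)%Z < (2 ^ bit_length (m * m))%:Z.
    have := absz_lt_bit_length (m * m).
    have : m * (b %% m)%Z <= m * m by apply: ler_pM; lia.
    lia.
  have [q1 q2] : (bit_length (b %/ m)%Z <= K)%N /\
                 (bit_length ((b %/ m)%Z * m) <= K)%N.
    have := bit_length_eval_op Mul (b %/ m)%Z m.
    have := bit_length_monotone (lez_div b m).
    by rewrite /K /=; lia.
  have NK : (bit_length (m * m) <= K)%N.
    by have := bit_length_eval_op Mul m m; rewrite /K /=; lia.
  move: B; have := @triple_bezout_loop K r m (bit_length (m * m)) (b %% m)%Z m
    0 1 i2 ((b %/ m)%Z * m) _ mK r0 rm.
  case: bezout_loop => g x [] //; try lia; move=> b' [x' [q' [z' T]]] [Bg Bx].
  exists [:: if f then g else x; m; g; x; x'; q'; z'; 0]; split; last by case: f.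
  apply: triple_weaken; last first.
    apply: triple_seq; first exact: triple_const.
    apply: triple_seq.
      apply: triple_if => //=; rewrite m0.
      apply: triple_seq; first by apply: (triple_op (K := K)).
      apply: triple_seq; first by apply: (triple_op (K := K)).
      apply: triple_seq; first by apply: (triple_op (K := K)).
      apply: triple_seq; first by apply: (triple_op (K := K)).
      apply: triple_seq; first exact: triple_const.
      apply: triple_seq; first exact: triple_const.
      rewrite /= addr0; exact: T.
    case: f; (apply: triple_eq; first by
      apply: (triple_op (K := K)) => //=; rewrite /K; lia);
      by rewrite /= addr0.
  have : ((bit_length (m * m) * 12).+1 * (K * K) <= (K * 12).+1 * (K * K))%N.
    by rewrite leq_mul2r ltnS leq_mul2r NK orbT.
  move: K KK K0 K1 Km {K2 Kb mK small q1 q2 NK T} => K KK K0 K1 Km.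
  by move: (K * K)%N KK => C KC /=; rewrite !mulSn !mulnDl; lia.
exists [:: if f then b else 1; m; b; 1; i1; i2; i3; 0]; split; last by case: f.
apply: triple_weaken; last first.
  apply: triple_seq; first exact: triple_const.
  apply: triple_seq.
    apply: triple_if => //=; rewrite ltNge m0 /=.
    apply: triple_seq; first by apply: (triple_op (K := K)).
    exact: triple_const.
  case: f; (apply: triple_eq; first by
    apply: (triple_op (K := K)) => //=; rewrite ?addr0);
    by rewrite /= !addr0.
move: K KK K0 K1 Km {K2 Kb} => K KK K0 K1 Km.
by move: (K * K)%N KK => C KC /=; rewrite !mulnDl; lia.
Qed.

(** * Straight-line expressions over the parameters *)

Inductive expr (k : nat) :=
| EInput of 'I_k
| EConst of int
| EOp of binop & expr k & expr k
| EIf of expr k & expr k & expr k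
| EBezout of bool & expr k & expr k.
Arguments EConst {k} v.

Fixpoint value k (e : expr k) (t : 'rV[int]_k) : int :=
  match e with
  | EInput i => t 0 i
  | EConst v => v
  | EOp o a b => eval_op o (value a t) (value b t)
  | EIf c a b => if 0 < value c t then value a t else value b t
  | EBezout first a b =>
      if first then (bezout (value a t) (value b t)).1
      else (bezout (value a t) (value b t)).2
  end.

(* The result is left in register r; the registers below r, which include the
   inputs when k <= r, are preserved. *)
Fixpoint compile k (e : expr k) (r : nat) : program :=
  match e with
  | EInput i => Seq (Const r 0) (Op Add r i r)
  | EConst v => Const r v
  | EOp o a b => Seq (compile a r) (Seq (compile b r.+1) (Op o r r r.+1))
  | EIf c a b => Seq (compile c r) (IfPos r (compile a r) (compile b r))
  | EBezout first a b =>
      Seq (compile a r) (Seq (compile b r.+1) (bezout_program first r))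
  end.

Lemma natpolyD (p q : {poly nat}) n : (p + q).[n] = (p.[n] + q.[n])%N.
Proof. exact: hornerD. Qed.

Lemma natpolyM (p q : {poly nat}) n : (p * q).[n] = (p.[n] * q.[n])%N.
Proof. exact: hornerM. Qed.

Lemma bit_length_input k (t : 'rV[int]_k) i :
  (bit_length (t 0%R i) <= input_size t + 1)%N.
Proof.
rewrite /input_size (bigD1 i) //= /bit_length.
by move: (log2z _) (\sum_(_ | _) _)%N => u v; lia.
Qed.

(** The shape of [e] is fixed, and each node at most adds the lengths of its operands; the bound is
    even linear. *)
Lemma bit_length_value k (e : expr k) : exists p : {poly nat},
  forall t, (bit_length (value e t) <= p.[input_size t])%N.
Proof.
elim: e => [i|v|o a [p Hp] b [q Hq]|c _ a [p Hp] b [q Hq]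
           |f a [p Hp] b [q Hq]].
- exists ('X + 1%:P) => t; rewrite natpolyD hornerX hornerC.
  exact: bit_length_input.
- by exists (bit_length v)%:P => t; rewrite hornerC.
- exists (p + q) => t; rewrite natpolyD.
  exact: leq_trans (bit_length_eval_op _ _ _) (leq_add (Hp t) (Hq t)).
- exists (p + q) => t; rewrite natpolyD /=.
  by case: ifP => _; [apply: leq_trans (Hp t) (leq_addr _ _)
                     |apply: leq_trans (Hq t) (leq_addl _ _)].
- exists (p + q) => t; rewrite natpolyD /=.
  have := bezout_bound (value a t) (value b t).
  case: bezout => g x [Hg Hx].
  by case: f; apply: leq_trans (leq_add (Hp t) (Hq t)).
Qed.

Lemma compileP k (e : expr k) : exists p : {poly nat}, forall (t : 'rV[int]_k) r
  (s : state), (k <= r)%N -> (forall i : 'I_k, s i = t 0 i) ->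
  exists n s', [/\ exec (compile e r) s n s', s' r = value e t,
    forall i, (i < r)%N -> s' i = s i & (n <= p.[input_size t])%N].
Proof.
(* Shared by operations and gcds: the second operand is computed from register [r.+1] on and thus
   spares the first one in [r], while [k <= r] protects the inputs. *)
have binary p q (a b : expr k) (t : 'rV[int]_k) r (s : state) c (C : nat) v :
    (forall r (s : state), (k <= r)%N -> (forall i : 'I_k, s i = t 0 i) ->
     exists n s', [/\ exec (compile a r) s n s', s' r = value a t,
       forall i, (i < r)%N -> s' i = s i & (n <= p)%N]) ->
    (forall r (s : state), (k <= r)%N -> (forall i : 'I_k, s i = t 0 i) ->
     exists n s', [/\ exec (compile b r) s n s', s' r = value b t,
       forall i, (i < r)%N -> s' i = s i & (n <= q)%N]) ->
    (forall s, s r = value a t -> s r.+1 = value b t -> exists n s',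
      [/\ exec c s n s', s' r = v, forall i, (i < r)%N -> s' i = s i &
         (n <= C)%N]) ->
    (k <= r)%N -> (forall i : 'I_k, s i = t 0 i) ->
    exists n s', [/\ exec (Seq (compile a r) (Seq (compile b r.+1) c)) s n s',
      s' r = v, forall i, (i < r)%N -> s' i = s i & (n <= p + (q + C))%N].
  move=> Ha Hb Hc kr st; have [na [s1 [E1 V1 F1 N1]]] := Ha r s kr st.
  have st1 (i : 'I_k) : s1 i = t 0 i by rewrite F1 // (leq_trans (ltn_ord i)).
  have [nb [s2 [E2 V2 F2 N2]]] := Hb r.+1 s1 (leqW kr) st1.
  have [|n [s3 [E3 V3 F3 N3]]] := Hc s2 _ V2; first by rewrite F2.
  exists (na + (nb + n))%N, s3; split=> //.
  - exact: ExecSeq E1 (ExecSeq E2 E3).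
  - by move=> i ir; rewrite F3 // F2 ?F1 // ltnW.
  - by rewrite !leq_add.
elim: e => [i|v|o a [p Hp] b [q Hq]|c [u Hu] a [p Hp] b [q Hq]
           |f a [p Hp] b [q Hq]].
- exists (1%:P + ('X + 1%:P)) => t r s kr st; rewrite !natpolyD hornerX !hornerC.
  have ir : (i < r)%N := leq_trans (ltn_ord i) kr.
  do 2 eexists; split; first exact: ExecSeq (ExecConst _ _ _) (ExecOp _ _ _ _ _).
  + by rewrite /update eqxx ltn_eqF //= addr0.
  + by move=> j jr; rewrite /update ltn_eqF.
  + by rewrite /update eqxx ltn_eqF // st muln1 leq_add2l bit_length_input.
- exists (bit_length v)%:P => t r s kr st; rewrite hornerC.
  do 2 eexists; split; [exact: ExecConst | | | exact: leqnn].
  + by rewrite /update eqxx.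
  + by move=> j jr; rewrite /update ltn_eqF.
- have [p' Hp'] := bit_length_value a; have [q' Hq'] := bit_length_value b.
  exists (p + (q + p' * q')) => t r s kr st; rewrite !natpolyD natpolyM.
  apply: binary (Hp t) (Hq t) _ kr st => s1 A B.
  do 2 eexists; split; first exact: ExecOp.
  + by rewrite /update eqxx A B.
  + by move=> j jr; rewrite /update ltn_eqF.
  + by rewrite A B; apply: leq_mul.
- have [w Hw] := bit_length_value c.
  exists (u + (w + (p + q))) => t r s kr st; rewrite !natpolyD.
  have [n0 [s1 [E1 V1 F1 N1]]] := Hu t r s kr st.
  have st1 (i : 'I_k) : s1 i = t 0 i by rewrite F1 // (leq_trans (ltn_ord i)).
  rewrite /=; case: ltP => c0.
  + have [n [s2 [E2 V2 F2 N2]]] := Hp t r s1 kr st1.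
    exists (n0 + (bit_length (s1 r) + n))%N, s2; split=> //.
    * by apply: ExecSeq E1 (ExecIfTrue _ _ E2); rewrite V1.
    * by move=> i ir; rewrite F2 ?F1.
    * by rewrite V1 leq_add // leq_add // (leq_trans N2) // leq_addr.
  + have [n [s2 [E2 V2 F2 N2]]] := Hq t r s1 kr st1.
    exists (n0 + (bit_length (s1 r) + n))%N, s2; split=> //.
    * by apply: ExecSeq E1 (ExecIfFalse _ _ E2); rewrite V1.
    * by move=> i ir; rewrite F2 ?F1.
    * by rewrite V1 leq_add // leq_add // (leq_trans N2) // leq_addl.
- have [p' Hp'] := bit_length_value a; have [q' Hq'] := bit_length_value b.
  pose K := 2%:P * (p' + q').
  exists (p + (q + (K * 12%:P + 11%:P) * (K * K))) => t r s kr st.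
  rewrite !(natpolyD, natpolyM, hornerC).
  apply: binary (Hp t) (Hq t) _ kr st => s1 A B.
  have [l [T [l0 V]]] := triple_bezout_program f r (value a t) (value b t)
    (size_mkseq (fun j => s1 (r + j.+2)%N) 6).
  have [|n [s2 [E N [F W]]]] := T s1 s1.
    split=> // -[|[|j]] jl; rewrite ?addn0 ?addn1 //.
    by rewrite [in RHS]/= -/(mkseq _ 6) nth_mkseq.
  exists n, s2; split=> //; first by rewrite -[r in LHS]addn0 W.
  apply: leq_trans N _.
  have := leq_add (Hp' t) (Hq' t).
  move: (_ + _)%N (_ + _)%N => x y xy.
  by rewrite !leq_mul ?leq_add ?leq_mul.
Qed.

(** The value is computed in register [k], above the inputs, and only then copied to the output
    register 0. *)
Lemma polytime_value k (e : expr k) : polytime_computable (value e).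
Proof.
have [p Hp] := compileP e; have [q Hq] := bit_length_value e.
exists (Seq (compile e k) (Seq (Const k.+1 0) (Op Add 0 k k.+1))), (p + (1%:P + q)).
move=> t; have [|n [s [E V F N]]] := Hp t k (input_state t) (leqnn k).
  by move=> i; rewrite /input_state valK.
do 2 eexists; split.
- exact: ExecSeq E (ExecSeq (ExecConst _ _ _) (ExecOp _ _ _ _ _)).
- by rewrite /update eqxx /= ltn_eqF // eqxx V addr0.
- rewrite !natpolyD hornerC /update eqxx ltn_eqF // V muln1.
  by rewrite !leq_add.
Qed.

Lemma polytime_eq k (f g : 'rV[int]_k -> int) : (forall t, f t = g t) ->
  polytime_computable f -> polytime_computable g.
Proof.
by move=> fg [c [p H]]; exists c, p => t; rewrite -fg.
Qed.

(** * Covering the integers by cosets *)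

(** Covers cosets of nonzero subgroups, single points and the empty set uniformly, as solution sets
    of congruences and equations may be any of these. *)
Definition affine (A : int -> bool) :=
  forall x y z, A x -> A y -> A z -> A (x - y + z).

Lemma affine_periodic A x y : affine A -> A x -> A y ->
  forall q z, A z -> A (z + q * (y - x)).
Proof.
move=> Aff Ax Ay q z Az; elim: q => [|n IH|n IH].
- by rewrite mul0r addr0.
- have -> : z + n.+1%:Z * (y - x) = y - x + (z + n%:Z * (y - x)).
    by rewrite -addn1 PoszD; ring.
  exact: Aff.
- have -> : z + (- n.+1%:Z) * (y - x) = x - y + (z + (- n%:Z) * (y - x)).
    by rewrite -addn1 PoszD; ring.
  exact: Aff.
Qed.

(* Either some coset misses a long subinterval, which the others then cover, or
   every coset has two elements at distance less than 2 b and is therefore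
   periodic modulo (2 b)!. *)
Lemma affine_covering N : exists B : nat, forall A : 'I_N -> int -> bool,
  (forall i, affine (A i)) ->
  forall s, (forall z, s <= z < s + B%:Z -> exists i, A i z) ->
  forall z, exists i, A i z.
Proof.
elim: N => [|N [b IH]].
  exists 1%N => A _ s H; have [|[]//] := H s; lia.
(* Leaves room for two adjacent blocks of length [b], whose elements differ by less than [2 * b],
   and for a full common period. *)
exists ((2 * b)`! + 2 * b)%N => A Aff s H.
set B := (_ + _)%N in H.
have [[j [s' [s1 s2 miss]]]|hit] := boolp.pselect (exists j s',
    [/\ s <= s', s' + b%:Z <= s + B%:Z &
      forall z, s' <= z < s' + b%:Z -> ~~ A j z]).
  have cov z : s' <= z < s' + b%:Z -> exists i, A (lift j i) z.
    move=> zs; have [|i Ai] := H z; first lia.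
    have := miss z zs; move: Ai; case: (unliftP j i) => [i' ->|->] Ai.
      by exists i'.
    by rewrite Ai.
  by move=> z; have [i Ai] := IH (A \o lift j) (fun i => Aff _) s' cov z;
    exists (lift j i).
have meet j s' : s <= s' -> s' + b%:Z <= s + B%:Z ->
    exists2 z, s' <= z < s' + b%:Z & A j z.
  move=> s1 s2; apply: boolp.contrapT => nex; apply: hit; exists j, s'.
  by split=> // z zs; apply/negP => Az; apply: nex; exists z.
have period j q z : A j z -> A j (z + q * ((2 * b)`!)%:Z).
  have [||x xs Ax] := meet j s; [lia|rewrite /B; lia|].
  have [||y ys Ay] := meet j (s + b%:Z); [lia|rewrite /B; lia|].
  have [d dE] : exists d : nat, y - x = d%:Z by exists `|y - x|%N; lia.
  have /dvdnP[c ->] : (d %| (2 * b)`!)%N by apply: dvdn_fact; lia.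
  by rewrite PoszM mulrA -dE; apply: affine_periodic.
move=> z; set D := ((2 * b)`!)%:Z in period.
have D0 : 0 < D by rewrite /D ltz_nat fact_gt0.
have [|i Ai] := H (s + ((z - s) %% D)%Z).
  rewrite lerDl modz_ge0 ?gt_eqF //= ltrD2l.
  by apply: lt_le_trans (ltz_pmod _ D0) _; rewrite /D /B; lia.
exists i; have /(period i ((z - s) %/ D)%Z) := Ai.
by rewrite -addrA [X in _ + X]addrC -divz_eq addrC subrK.
Qed.

(** After division by [g], [x] inverts [b] modulo [m], so the solutions are [(- x * u + m * z) / g].
    If [g = 0], then [b = m = 0] and every [w] is a solution once [u = 0]; replacing [g] and [m] by
    1 then gives [w = z]. *)
Lemma congruence_solutions (b m u g x y : int) :
  (g %| b)%Z -> (g %| m)%Z -> g = x * b + y * m ->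
  let g1 := if 0 < g * g then g else 1 in
  let h := if 0 < g * g then m else 1 in
  [/\ g1 != 0,
     (forall w, (m %| u + b * w)%Z -> (g %| u)%Z /\
       exists z, g1 * w = - x * u + h * z),
     (forall w z, (g %| u)%Z -> g1 * w = - x * u + h * z ->
       (m %| u + b * w)%Z) &
     (forall z, (g %| u)%Z -> exists w, g1 * w = - x * u + h * z)].
Proof.
move=> /dvdzP[b1 bE] /dvdzP[m1 mE] gE /=; case: ltP => [gg|gg]; last first.
  have g0 : g = 0 by nia.
  rewrite g0 !mulr0 in bE mE; rewrite bE mE g0; split=> //.
  - move=> w; rewrite mul0r addr0 => u0; split=> //.
    by exists w; move: u0; rewrite dvd0z => /eqP ->; rewrite mulr0 add0r !mul1r.
  - by move=> w z; rewrite mul0r addr0.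
  - move=> z; rewrite dvd0z => /eqP ->.
    by exists z; rewrite mulr0 add0r.
have g0 : g != 0 by apply/eqP => g0; rewrite g0 in gg.
have one : x * b1 + y * m1 = 1.
  by apply: (mulIf g0); rewrite mul1r {2}gE bE mE; ring.
split=> //.
- move=> w /dvdzP[q qE]; have uE : u = q * m - b * w by rewrite -qE; ring.
  split; last by exists (x * q + y * w); rewrite uE {1}gE; ring.
  by apply/dvdzP; exists (q * m1 - b1 * w); rewrite uE bE mE; ring.
- move=> w z /dvdzP[u1 uE] wE; apply/dvdzP; exists (y * u1 + b1 * z).
  have {}wE : w = - x * u1 + m1 * z.
    by apply: (mulfI g0); rewrite wE uE mE; ring.
  rewrite wE uE bE mE -[u1 * g]mul1r -[in LHS]one; ring.
- move=> z /dvdzP[u1 ->]; exists (- x * u1 + m1 * z); rewrite mE; ring.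
Qed.

(** * Formulas *)

Section Formulas.
Variable k : nat.
Implicit Types (t : 'rV[int]_k) (v w : nat -> int).

(* The congruence [sum_i coef_i v_i = 0 mod modulus], an equation when the
   modulus vanishes. The variable v_0 is always 1, so coef_0 is the constant
   term. *)
Record congruence := Congruence { coef : nat -> expr k; modulus : expr k }.

Inductive formula :=
| FAtom of congruence
| FNot of formula
| FAnd of formula & formula.

Definition linear_form n (f : nat -> expr k) t v : int :=
  \sum_(i < n) value (f i) t * v i.

Definition sat_atom n t v (a : congruence) : bool :=
  (value (modulus a) t %| linear_form n (coef a) t v)%Z.

Fixpoint sat n t v (phi : formula) : bool :=
  match phi with
  | FAtom a => sat_atom n t v a
  | FNot phi1 => ~~ sat n t v phi1
  | FAnd phi1 phi2 => sat n t v phi1 && sat n t v phi2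
  end.

Definition set_var v n y : nat -> int := fun i => if i == n then y else v i.

Lemma linear_form_ext n f t v w : (forall i, (i < n)%N -> v i = w i) ->
  linear_form n f t v = linear_form n f t w.
Proof. by move=> vw; apply: eq_bigr => i _; rewrite vw. Qed.

Lemma sat_ext n t v w phi : (forall i, (i < n)%N -> v i = w i) ->
  sat n t v phi = sat n t w phi.
Proof.
move=> vw; elim: phi => [a|p IH|p IHp q IHq] /=; last 2 first.
- by rewrite IH.
- by rewrite IHp IHq.
- by rewrite /sat_atom (linear_form_ext _ _ vw).
Qed.

Lemma linear_form_set n f t v y :
  linear_form n.+1 f t (set_var v n y) = linear_form n f t v + value (f n) t * y.
Proof.
rewrite /linear_form big_ord_recr /= /set_var eqxx; congr (_ + _).
by apply: eq_bigr => i _; rewrite ltn_eqF.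
Qed.

Lemma sat_FNot n t v p : sat n t v (FNot p) = ~~ sat n t v p.
Proof. by []. Qed.

Definition FTrue := FAtom (Congruence (fun=> EConst 0) (EConst 0)).

Definition FAll (s : seq formula) : formula := foldr FAnd FTrue s.

Definition FHas (s : seq formula) : formula := FNot (FAll [seq FNot p | p <- s]).

Lemma sat_FAll n t v s : sat n t v (FAll s) = all (sat n t v) s.
Proof.
elim: s => [|p s /= <-] //=; rewrite /sat_atom /linear_form big1 ?dvdzz // => i.
by rewrite mul0r.
Qed.

Lemma sat_FHas n t v s : sat n t v (FHas s) = has (sat n t v) s.
Proof. by rewrite /= sat_FAll all_map -[RHS]negbK -all_predC. Qed.

(** The flag [b] is the truth value required of [phi], which pushes negations down to the atoms. *)
Fixpoint dnf (b : bool) (phi : formula) : seq (seq (bool * congruence)) :=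
  match phi with
  | FAtom a => [:: [:: (b, a)]]
  | FNot p => dnf (~~ b) p
  | FAnd p q =>
      if b then [seq c ++ d | c <- dnf b p, d <- dnf b q]
      else dnf b p ++ dnf b q
  end.

Lemma dnfP n t v b phi :
  has (all (fun l => sat_atom n t v l.2 == l.1)) (dnf b phi) =
  (sat n t v phi == b).
Proof.
elim: phi b => [a|p IH|p IHp q IHq] b /=.
- by rewrite andbT orbF.
- by rewrite IH; case: sat; case: b.
- case: b; last by rewrite has_cat IHp IHq; do 2 case: sat.
  rewrite eqb_id -[sat n t v p]eqb_id -[sat n t v q]eqb_id -IHp -IHq.
  elim: (dnf true p) => //= c s IHs; rewrite has_cat IHs andb_orl; congr (_ || _).
  rewrite has_map; elim: (dnf true q) => [|d r IHr] /=; first by rewrite andbF.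
  by rewrite IHr all_cat andb_orr.
Qed.

(** * Quantifier elimination *)

Definition substitute_constant n (z : int) (a : congruence) :=
  Congruence (fun i => if i == 0 then
    EOp Add (coef a 0) (EOp Mul (coef a n) (EConst z)) else coef a i)
    (modulus a).

Lemma sat_substitute_constant n z t v a : (0 < n)%N -> v 0%N = 1 ->
  sat_atom n t v (substitute_constant n z a) = sat_atom n.+1 t (set_var v n z) a.
Proof.
case: n => // n _ v0; rewrite /sat_atom linear_form_set /=; congr (_ %| _)%Z.
rewrite /linear_form !big_ord_recl /= v0 !mulr1 addrAC; congr (_ + _).
Qed.

Definition abs_expr (a : expr k) := EIf a a (EOp Defs.Sub (EConst 0) a).

Lemma value_abs a t : value (abs_expr a) t = `|value a t|.
Proof. by rewrite /=; case: ltP; lia. Qed.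

Lemma value_op o (a b : expr k) t :
  value (EOp o a b) t = eval_op o (value a t) (value b t).
Proof. by []. Qed.

Lemma dvdz_norml (m x : int) : (`|m| %| x)%Z = (m %| x)%Z.
Proof. by rewrite -abszE !dvdzE absz_nat. Qed.

Section Reparametrize.
Variables (n : nat) (a : congruence).

Let gcd_e := EBezout true (coef a n) (abs_expr (modulus a)).
Let bez_e := EBezout false (coef a n) (abs_expr (modulus a)).
Let gcd1 := EIf (EOp Mul gcd_e gcd_e) gcd_e (EConst 1).
Let step := EIf (EOp Mul gcd_e gcd_e) (abs_expr (modulus a)) (EConst 1).

Definition solvable := Congruence (coef a) gcd_e.

(* The solutions y of [a] are given by [gcd1 y = - bez u + step z] with z free,
   where u is the part of the linear form of [a] without the variable n. *)
Definition reparametrize (c : congruence) :=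
  Congruence (fun i => if i == n then EOp Mul (coef c n) step
    else EOp Defs.Sub (EOp Mul gcd1 (coef c i))
           (EOp Mul (EOp Mul (coef c n) bez_e) (coef a i)))
    (EOp Mul gcd1 (modulus c)).

(** Multiplying a congruence and its modulus by the nonzero [gcd1] preserves its truth, and
    [gcd1 * y] can then be replaced by its parametrization. One positive congruence in [y]
    disappears. *)
Lemma reparametrizeP t v (pos neg : seq congruence) :
  (exists y, all (sat_atom n.+1 t (set_var v n y)) (a :: pos) &&
             ~~ has (sat_atom n.+1 t (set_var v n y)) neg) <->
  sat_atom n t v solvable /\
  (exists z, all (sat_atom n.+1 t (set_var v n z)) (map reparametrize pos) &&
             ~~ has (sat_atom n.+1 t (set_var v n z)) (map reparametrize neg)).
Proof.
have := bezoutP (value (coef a n) t) (normr_ge0 (value (modulus a) t)).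
case E: bezout => [g x] [gb gm [y gE]].
have := congruence_solutions (linear_form n (coef a) t v) gb gm gE.
have [vg vx] : value gcd_e t = g /\ value bez_e t = x.
  by rewrite /gcd_e /bez_e /= -value_abs in E *; rewrite E.
set g1 := if _ then _ else _; set h := if _ then _ else _ => -[g10 H1 H2 H3].
have vg1 : value gcd1 t = g1 by rewrite /g1 -vg.
have vh : value step t = h by rewrite /h -vg -value_abs.
have repl (w z : int) c : g1 * w = - x * linear_form n (coef a) t v + h * z ->
    sat_atom n.+1 t (set_var v n z) (reparametrize c) =
    sat_atom n.+1 t (set_var v n w) c.
  move=> wE; rewrite /sat_atom !linear_form_set.
  rewrite -[RHS](@dvdz_mul2l _ _ _ g10) [in RHS]mulrDr mulrCA wE.
  have -> : linear_form n (coef (reparametrize c)) t v =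
      g1 * linear_form n (coef c) t v -
      value (coef c n) t * x * linear_form n (coef a) t v.
    rewrite /linear_form !mulr_sumr -sumrB; apply: eq_bigr => i _.
    rewrite [coef _ _]/= ltn_eqF //.
    by rewrite !value_op vg1 vx /= mulrBl !mulrA.
  rewrite [modulus _]/= [coef (reparametrize c) n]/= eqxx !value_op vg1 vh /=.
  by congr (_ %| _)%Z; ring.
have sol : sat_atom n t v solvable = (g %| linear_form n (coef a) t v)%Z.
  by rewrite -vg.
rewrite sol; split=> [[w /andP[/andP[aw pw] nw]]|[gu [z /andP[pz nz]]]].
  rewrite /sat_atom linear_form_set in aw.
  have [|gu [z wE]] := H1 w; first by rewrite dvdz_norml.
  split=> //; exists z.
  rewrite all_map has_map (eq_all (fun c => repl w z c wE)).
  by rewrite (eq_has (fun c => repl w z c wE)); apply/andP.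
have [w wE] := H3 z gu; exists w.
rewrite all_map has_map (eq_all (fun c => repl w z c wE)) in pz nz.
rewrite (eq_has (fun c => repl w z c wE)) in nz.
by rewrite /= pz nz !andbT /sat_atom linear_form_set -dvdz_norml; apply: H2 wE.
Qed.

End Reparametrize.

Lemma eliminate_clause n (pos neg : seq congruence) : (0 < n)%N ->
  exists psi, forall t v, v 0%N = 1 -> sat n t v psi <->
    exists y, all (sat_atom n.+1 t (set_var v n y)) pos &&
              ~~ has (sat_atom n.+1 t (set_var v n y)) neg.
Proof.
move=> n0; have [N Np] := ubnP (size pos).
elim: N pos neg Np => // N IH [|a pos] neg Np; last first.
  have [|psi H] := IH (map (reparametrize n a) pos) (map (reparametrize n a) neg).
    by rewrite size_map.
  exists (FAnd (FAtom (solvable n a)) psi) => t v v0.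
  apply: iff_trans (iff_sym (reparametrizeP _ _ _ _ _ _)).
  have [H1 H2] := H t v v0.
  by split=> [/andP[A /H1 B]|[A /H2 B]]; [|apply/andP].
(* Only negated congruences remain. If each of 0, ..., [B - 1] violates one, the affine sets [A i]
   cover all integers, including the given [y]. *)
have [B covering] := affine_covering (size neg).
pose test z := FNot (FHas [seq FAtom (substitute_constant n z c) | c <- neg]).
have testP t v z : v 0%N = 1 -> sat n t v (test z) =
    ~~ has (sat_atom n.+1 t (set_var v n z)) neg.
  move=> v0; rewrite /test sat_FNot sat_FHas has_map.
  by congr (~~ _); apply: eq_has => c /=; rewrite sat_substitute_constant.
exists (FHas [seq test z%:Z | z <- iota 0 B]) => t v v0.
rewrite sat_FHas has_map; split=> [/hasP[z _ Hz]|[y /= ny]].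
  have {Hz} : sat n t v (test z%:Z) := Hz.
  by rewrite testP //; exists z%:Z.
apply: contraT => /hasPn none.
have {}none z : (z < B)%N -> ~~ sat n t v (test z%:Z).
  by move=> zB; apply: none; rewrite mem_iota.
pose d := Congruence (fun=> EConst 0) (EConst 0).
pose A (i : 'I_(size neg)) y := sat_atom n.+1 t (set_var v n y) (nth d neg i).
have aff i : affine (A i).
  move=> x1 x2 x3; rewrite /A /sat_atom !linear_form_set.
  move: (nth _ _ _) => c; set u := linear_form _ _ _ _; set b := value _ _.
  move=> D1 D2 D3; have -> : u + b * (x1 - x2 + x3) =
    (u + b * x1) - (u + b * x2) + (u + b * x3) by ring.
  by apply: rpredD => //; apply: rpredB.
have [|i Ai] := covering A aff 0 _ y; last first.
  by case/negP: ny; apply/(has_nthP d); exists i.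
move=> z /andP[z0 zB].
have [z' zE] : exists z' : nat, z = z'%:Z by exists `|z|%N; lia.
have := none z'; rewrite testP // negbK -zE => H.
have [|i ic Ai] := has_nthP d (H _); first lia.
by exists (Ordinal ic).
Qed.

Lemma eliminate_exists n phi : (0 < n)%N ->
  exists psi, forall t v, v 0%N = 1 ->
    sat n t v psi <-> exists y, sat n.+1 t (set_var v n y) phi.
Proof.
move=> n0.
(* The existential quantifier distributes over the clauses of the normal form. *)
suff [psi H] : exists psi, forall t v, v 0%N = 1 -> sat n t v psi <->
    exists y, has (all (fun l => sat_atom n.+1 t (set_var v n y) l.2 == l.1))
                  (dnf true phi).
  exists psi => t v v0; apply: iff_trans (H t v v0) _.
  by split=> -[y Hy]; exists y; move: Hy; rewrite dnfP eqb_id.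
elim: (dnf true phi) => [|c s [psi H]].
  exists (FNot FTrue) => t v v0; split=> [|[]] //.
  by have := sat_FAll n t v [::] => /= ->.
pose pos := [seq l.2 | l <- c & l.1]; pose neg := [seq l.2 | l <- c & ~~ l.1].
have split_clause (f : congruence -> bool) :
    all (fun l => f l.2 == l.1) c = all f pos && ~~ has f neg.
  rewrite /pos /neg; elim: c {pos neg} => //= -[[] a] c -> /=.
    by rewrite eqb_id andbA.
  by rewrite eqbF_neg negb_or andbCA.
have [chi H'] := @eliminate_clause n pos neg n0.
exists (FHas [:: chi; psi]) => t v v0; rewrite sat_FHas /= orbF.
split=> [/orP[/(H' t v v0)|/(H t v v0)] [y Hy]|[y /orP[Hy|Hy]]].
- by exists y; rewrite split_clause Hy.
- by exists y; rewrite Hy orbT.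
- by apply/orP; left; apply/(H' t v v0); exists y; rewrite -split_clause.
- by apply/orP; right; apply/(H t v v0); exists y.
Qed.

End Formulas.

(** * Expressions for polynomials and formulas *)

Section Evaluation.
Variable k : nat.
Implicit Types (t : 'rV[int]_k) (v w : nat -> int).

Definition monomial_expr (m : 'X_{1..k}) : expr k :=
  foldr (fun i => EOp Mul (iter (m i) (EOp Mul (EInput i)) (EConst 1)))
    (EConst 1) (index_enum 'I_k).

Definition poly_expr (p : {mpoly int[k]}) : expr k :=
  foldr (fun m => EOp Add (EOp Mul (EConst p@_m) (monomial_expr m)))
    (EConst 0) (msupp p).

Lemma value_poly p t : value (poly_expr p) t = p.@[t 0].
Proof.
rewrite mevalE /poly_expr; elim: (msupp p) => [|m s IH]; first by rewrite big_nil.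
rewrite big_cons -IH /=; congr (_ * _ + _).
rewrite /monomial_expr; elim: (index_enum _) => [|i r IHr]; first by rewrite big_nil.
rewrite big_cons -IHr /=; congr (_ * _).
by elim: (m i) => //= j ->; rewrite exprS.
Qed.

(** Truth values are encoded as 0 and 1, with multiplication as conjunction. *)
Definition not_expr (a : expr k) := EOp Defs.Sub (EConst 1) a.

(** Squaring turns the positivity test of [EIf] into a test for being nonzero. *)
Definition zero_expr (a : expr k) := EIf (EOp Mul a a) (EConst 0) (EConst 1).

Definition all_expr (s : seq (expr k)) := foldr (EOp Mul) (EConst 1) s.

Lemma value_not a t (b : bool) : value a t = b%:Z -> value (not_expr a) t = (~~ b)%:Z.
Proof. by move=> /= ->; case: b. Qed.

Lemma sqr_gt0 (x : int) : (0 < x * x) = (x != 0).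
Proof. by rewrite -expr2 exprn_even_gt0. Qed.

Lemma value_zero a t : value (zero_expr a) t = (value a t == 0)%:Z.
Proof. by rewrite /= sqr_gt0; case: eqP. Qed.

Lemma value_all (I : Type) (s : seq I) (E : I -> expr k) (b : I -> bool) t :
  (forall i, value (E i) t = (b i)%:Z) ->
  value (all_expr [seq E i | i <- s]) t = (all b s)%:Z.
Proof.
move=> Eb; elim: s => //= i s ->; rewrite Eb.
by case: (b i); rewrite ?mul1r ?mul0r.
Qed.

Definition linear_expr n (f P : nat -> expr k) : expr k :=
  foldr (fun i => EOp Add (EOp Mul (f i) (P i))) (EConst 0) (iota 0 n).

Lemma value_linear n f P t :
  value (linear_expr n f P) t = linear_form n f t (fun i => value (P i) t).
Proof.
rewrite /linear_form -(big_mkord xpredT (fun i => value (f i) t * value (P i) t)).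
rewrite /linear_expr /index_iota subn0; elim: (iota 0 n) => [|i s IH].
  by rewrite big_nil.
by rewrite big_cons -IH.
Qed.

(** Since division by 0 yields 0, the remainder modulo 0 is [u] itself, so equations and congruences
    are tested alike. *)
Fixpoint sat_expr n (P : nat -> expr k) (phi : formula k) : expr k :=
  match phi with
  | FAtom a =>
      let u := linear_expr n (coef a) P in
      zero_expr (EOp Defs.Sub u (EOp Mul (EOp Div u (modulus a)) (modulus a)))
  | FNot p => not_expr (sat_expr n P p)
  | FAnd p q => EOp Mul (sat_expr n P p) (sat_expr n P q)
  end.

Lemma value_sat n P phi t :
  value (sat_expr n P phi) t = (sat n t (fun i => value (P i) t) phi)%:Z.
Proof.
elim: phi => [a|p IH|p IHp q IHq].
- rewrite [sat_expr _ _ _]/= value_zero !value_op value_linear /= -/(modz _ _).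
  by congr (nat_of_bool _)%:Z; apply/eqP/idP => [/dvdz_mod0P|/dvdz_mod0P].
- exact: value_not.
- by rewrite /= IHp IHq; do 2 case: sat.
Qed.

(** * Finite sets of integers defined by a formula in one variable *)

Definition line p : nat -> int := fun i => if i is 0%N then 1 else p.

Lemma linear_form_line f t p :
  linear_form 2 f t (line p) = value (f 0%N) t + value (f 1%N) t * p.
Proof. by rewrite /linear_form !big_ord_recl big_ord0 /= mulr1 addr0. Qed.

Fixpoint atoms (phi : formula k) : seq (congruence k) :=
  match phi with
  | FAtom a => [:: a]
  | FNot p => atoms p
  | FAnd p q => atoms p ++ atoms q
  end.

(** The division is exact if [a] is an equation with nonzero coefficient and a solution; otherwise
    the value is merely an extra candidate. *)
Definition solution_expr (a : congruence k) :=
  EOp Div (EOp Defs.Sub (EConst 0) (coef a 0)) (coef a 1).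

(* Replaces each equation that involves the variable, and hence has at most one
   solution, by the false equation 1 = 0. *)
Definition periodic_atom (a : congruence k) : congruence k :=
  let m2 := EOp Mul (modulus a) (modulus a) in
  Congruence (fun i => if i == 0 then
      EIf m2 (coef a 0)
        (EIf (EOp Mul (coef a 1) (coef a 1)) (EConst 1) (coef a 0))
    else EIf m2 (coef a i) (EConst 0)) (modulus a).

Fixpoint periodic_part (phi : formula k) : formula k :=
  match phi with
  | FAtom a => FAtom (periodic_atom a)
  | FNot p => FNot (periodic_part p)
  | FAnd p q => FAnd (periodic_part p) (periodic_part q)
  end.

Definition exceptional phi t := [seq value (solution_expr a) t | a <- atoms phi].

(** Away from its only possible solution, a nontrivial equation is as false as its replacement; all
    other atoms keep their meaning. *)
Lemma sat_periodic_part phi t p : p \notin exceptional phi t ->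
  sat 2 t (line p) (periodic_part phi) = sat 2 t (line p) phi.
Proof.
rewrite /exceptional.
elim: phi => [a|q IH|q IHq r IHr] /= H; last 2 first.
- by rewrite IH.
- by move: H; rewrite map_cat mem_cat negb_or => /andP[/IHq -> /IHr ->].
rewrite /sat_atom !linear_form_line /= !sqr_gt0.
move: H; rewrite inE; set b := value (coef a 1) t; set u := value (coef a 0) t.
have [m0|//] := eqVneq (value (modulus a) t) 0; rewrite m0 mul0r addr0 !dvd0z.
have [->|b0] /= := eqVneq b 0; first by rewrite mul0r addr0.
move=> pE; apply/esym/negbTE; apply: contraNneq pE => E.
by rewrite sub0r (_ : - u = p * b) ?mulzK //; lia.
Qed.

(** The product of the nonzero moduli is a period, since atoms of modulus 0 have become independent
    of the variable. *)
Lemma periodic_part_periodic phi t : exists2 D : int, D != 0 & forall q p,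
  sat 2 t (line (p + q * D)) (periodic_part phi) =
  sat 2 t (line p) (periodic_part phi).
Proof.
elim: phi => [a|f [D D0 IH]|f [D D0 IHf] g [D' D'0 IHg]] /=; last 2 first.
- by exists D => // q p; rewrite IH.
- exists (D * D'); first by rewrite mulf_neq0.
  by move=> q p; rewrite mulrA IHg mulrAC IHf.
exists (if value (modulus a) t == 0 then 1 else value (modulus a) t).
  by case: ifP => // /negbT.
move=> q p; rewrite /sat_atom !linear_form_line /= !sqr_gt0.
case: eqP => [_|_] /=; first by rewrite !mul0r.
move: (value (modulus a) t) (value (coef a 0) t) (value (coef a 1) t) => m u b.
have -> : u + b * (p + q * m) = u + b * p + b * q * m by ring.
apply/idP/idP => H; last by apply: rpredD => //; apply: dvdz_mull.
rewrite -[u + b * p](addrK (b * q * m)).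
by apply: rpredB => //; apply: dvdz_mull.
Qed.

(** A point of the periodic part has infinitely many translates there, and each lies in [s] or is
    exceptional: one more translate than that list has entries is a contradiction. *)
Lemma finite_line phi t (s : seq int) p :
  (forall p, sat 2 t (line p) phi -> p \in s) ->
  ~~ sat 2 t (line p) (periodic_part phi).
Proof.
move=> fin; apply/negP => H.
have [D D0 per] := periodic_part_periodic phi t.
pose r := s ++ exceptional phi t.
have := @uniq_leq_size _ [seq p + i%:Z * D | i <- iota 0 (size r).+1] r.
rewrite size_map size_iota ltnn => E; have {E} : false; last by [].
apply: E; first rewrite map_inj_uniq ?iota_uniq // => i j.
  by move=> /addrI /(mulIf D0) [].
move=> _ /mapP[i _ ->]; rewrite mem_cat.
case: (boolP (_ \in exceptional _ _)) => [|nex]; first by rewrite orbT.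
by rewrite orbF fin // -sat_periodic_part // per.
Qed.

End Evaluation.

(** * Translation of families *)

Section Translation.
Variable k : nat.
Implicit Types (t : 'rV[int]_k) (v w : nat -> int).

(* Besides the constant 1, one spare variable v_1 = p precedes the point x; it
   later receives the values of a coordinate of x. *)
Definition point_env N p (x : 'rV[int]_N) : nat -> int := fun i =>
  match i with
  | 0 => 1
  | 1 => p
  | j.+2 => if insub j is Some j then x 0 j else 0
  end.

Lemma point_env_ord N p (x : 'rV[int]_N) (j : 'I_N) :
  point_env p x j.+2 = x 0 j.
Proof. by rewrite /= valK. Qed.

Lemma point_env_rowA N1 N2 N3 p (x : 'rV[int]_N1) (y : 'rV[int]_N2)
    (z : 'rV[int]_N3) i :
  point_env p (row_mx (row_mx x y) z) i = point_env p (row_mx x (row_mx y z)) i.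
Proof.
rewrite row_mxA; move: (row_mx (row_mx x y) z) (esym _) => /= A E.
by case: _ / E; rewrite castmx_id.
Qed.

Lemma point_env_rcons N p (x : 'rV[int]_N) (y : int) i : (i < N.+3)%N ->
  point_env p (row_mx x (y%:M : 'rV_1)) i = set_var (point_env p x) N.+2 y i.
Proof.
case: i => [|[|j]] //; rewrite !ltnS leq_eqVlt /set_var !eqSS.
case: eqVneq => [-> _|_ jN].
  transitivity (point_env p (row_mx x (y%:M : 'rV_1)) (rshift N (@ord0 0)).+2).
    by congr (point_env _ _ _.+2); rewrite /= addn0.
  by rewrite point_env_ord row_mxEr mxE.
rewrite -[j]/(val (lshift 1 (Ordinal (jN : (j < N)%N)))) point_env_ord row_mxEl.
by rewrite -(point_env_ord p).
Qed.

Definition equation_atom d m (q : linear_equation k d m) : congruence k :=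
  Congruence (fun i => match i with
    | 0 => EOp Defs.Sub (EConst 0) (poly_expr (rhs q))
    | 1 => EConst 0
    | j.+2 => if insub j is Some j
              then poly_expr (row_mx (xcoef q) (ycoef q) 0 j) else EConst 0
    end) (EConst 0).

Fixpoint translate d m (b : boolean_combination k d m) : formula k :=
  match b with
  | Atom q => FAtom (equation_atom q)
  | Neg b1 => FNot (translate b1)
  | Conj b1 b2 => FAnd (translate b1) (translate b2)
  | Disj b1 b2 => FNot (FAnd (FNot (translate b1)) (FNot (translate b2)))
  end.

Lemma translateP d m (b : boolean_combination k d m) t p x y :
  sat (d + m).+2 t (point_env p (row_mx x y)) (translate b) <->
  combination_holds b t x y.
Proof.
elim: b => [q|b IH|b IHb c IHc|b IHb c IHc] /=.
- rewrite /sat_atom dvd0z /equation_holds.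
  rewrite /linear_form !big_ord_recl /= mul0r !add0r mulr1 value_poly.
  under eq_bigr => i _ do rewrite add0n valK value_poly.
  rewrite big_split_ord /= [X in X == _]addrC subr_eq0.
  under eq_bigr => i _ do rewrite !row_mxEl.
  under [X in _ + X == _]eq_bigr => i _ do rewrite !row_mxEr.
  by split=> [/eqP|->].
- by rewrite -IH; split=> /negP.
- by rewrite -IHb -IHc; split=> /andP.
- by rewrite -IHb -IHc -negb_or negbK; split=> /orP.
Qed.

Lemma quantify_iff (Q : seq quantifier) (P P' : 'rV[int]_(size Q) -> Prop) :
  (forall y, P y <-> P' y) -> quantify P <-> quantify P'.
Proof.
move=> PP'; suff -> : P = P' by [].
by apply: boolp.funext => y; apply: boolp.propext.
Qed.

(** The outermost variable joins the point as a new last coordinate, the remaining prefix is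
    eliminated by induction, and then this variable is. A universal quantifier is a negated
    existential one. *)
Lemma eliminate_prefix (Q : seq quantifier) N (phi : formula k) :
  exists psi, forall t p (x : 'rV[int]_N), sat N.+2 t (point_env p x) psi <->
    quantify (fun y : 'rV_(size Q) =>
      sat (N + size Q).+2 t (point_env p (row_mx x y)) phi).
Proof.
elim: Q N => [|q Q IH] N.
  exists phi => t p x /=; suff -> : sat N.+2 t (point_env p x) phi =
    sat (N + 0).+2 t (point_env p (row_mx x (0 : 'rV_0))) phi by [].
  transitivity (sat (N + 0).+2 t (point_env p x) phi); first by rewrite addn0.
  apply: sat_ext => -[|[|j]] // jN0.
  have jN : (j < N)%N by rewrite addn0 in jN0.
  rewrite -[j]/(val (lshift 0 (Ordinal jN))) [RHS]point_env_ord row_mxEl.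
  by rewrite -(point_env_ord p).
have [psi H] := IH (N + 1)%N.
have step t p (x : 'rV[int]_N) y1 : sat N.+3 t (set_var (point_env p x) N.+2 y1) psi <->
    quantify (fun y : 'rV_(size Q) => sat (N + (size Q).+1).+2 t
      (point_env p (row_mx x (row_mx (y1%:M : 'rV_1) y))) phi).
  rewrite -(sat_ext _ _ (@point_env_rcons N p x y1)).
  have -> : N.+3 = (N + 1).+2 by rewrite addn1.
  apply: iff_trans (H _ _ _) _; apply: quantify_iff => y.
  rewrite (sat_ext _ _ (fun i _ => point_env_rowA p x _ y i)).
  by have -> : (N + 1 + size Q)%N = (N + (size Q).+1)%N by rewrite -addnA.
case: q => /=.
  have [chi C] := @eliminate_exists k N.+2 (FNot psi) isT.
  exists (FNot chi) => t p x; split=> [/negP nchi y1|all_y].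
    by apply/step; apply: contraT => npsi; case: nchi; apply/C => //; exists y1.
  by apply/negP => /C[] // y1 /negP; apply; apply/step.
have [chi C] := @eliminate_exists k N.+2 psi isT.
exists chi => t p x; apply: iff_trans (C _ _ _) _ => //.
by split=> -[y1 /step]; exists y1.
Qed.

Lemma eliminate_point d (phi : formula k) : exists psi, forall t p,
  sat 2 t (line p) psi <->
  exists x : 'rV[int]_d, sat d.+2 t (point_env p x) phi.
Proof.
(* Arbitrary environments replace row vectors, so that the induction on [d] can drop the last
   variable directly. *)
suff [psi H] : exists psi, forall t p, sat 2 t (line p) psi <->
    exists w, [/\ w 0%N = 1, w 1%N = p & sat d.+2 t w phi].
  exists psi => t p; apply: iff_trans (H t p) _.
  split=> [[w [w0 w1 sw]]|[x sx]]; last by exists (point_env p x).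
  exists (\row_j w j.+2); rewrite (sat_ext _ _ (w := w)) // => -[|[|j]] //.
  rewrite !ltnS => jd; rewrite -[j]/(val (Ordinal jd)) point_env_ord.
  by rewrite mxE.
elim: d phi => [|d IH] phi.
  exists phi => t p; split=> [s|[w [w0 w1 s]]]; first by exists (line p).
  by rewrite (sat_ext _ _ (w := w)) // => -[|[|]].
have [phi' H] := @eliminate_exists k d.+2 phi isT.
have [psi H'] := IH phi'; exists psi => t p; apply: iff_trans (H' t p) _.
split=> -[w [w0 w1 sw]].
  by have /H[//|y sy] := sw; exists (set_var w d.+2 y).
exists w; split=> //; apply/H => //; exists (w d.+2).
rewrite (sat_ext _ _ (w := w)) // => i _; rewrite /set_var.
by case: eqP => [->|].
Qed.

Lemma member_formula d (F : unordered_family k d) : exists phi, forall t p x,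
  sat d.+2 t (point_env p x) phi <-> member F t x.
Proof.
have [psi H] := eliminate_prefix (Defs.prefix F) d (translate (body F)).
exists psi => t p x; apply: iff_trans (H t p x) _.
by apply: quantify_iff => y; apply: translateP.
Qed.

(** The equation [x_i - p = 0] ties the spare variable to the coordinate before the point is
    eliminated. *)
Lemma projection_formula d (phi : formula k) (i : 'I_d) : exists psi,
  forall t p, sat 2 t (line p) psi <->
    exists x : 'rV[int]_d, sat d.+2 t (point_env p x) phi /\ x 0 i = p.
Proof.
pose c := Congruence (fun j => if j == 1 then EConst (- 1) else
  if j == i.+2 then EConst 1 else EConst 0) (EConst 0 : expr k).
have [psi H] := eliminate_point d (FAnd phi (FAtom c)).
have cP t p x : sat_atom d.+2 t (point_env p x) c = (x 0 i == p).
  rewrite /sat_atom dvd0z /linear_form !big_ord_recl (bigD1 i) //= eqxx.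
  rewrite valK big1 => [|j ji]; last first.
    by rewrite !eqSS (inj_eq val_inj) (negbTE ji) mul0r.
  by rewrite addr0 mul0r add0r mulN1r mul1r addrC subr_eq0.
exists psi => t p; apply: iff_trans (H t p) _.
split=> -[x].
  by move=> /= /andP[sx]; rewrite cP => /eqP xp; exists x.
by move=> [sx xp]; exists x; rewrite /= sx cP xp eqxx.
Qed.

End Translation.

(** * Counting *)

Section Counting.
Variables k d : nat.
Implicit Types (t : 'rV[int]_k) (P Q : 'I_d -> expr k).

Definition point_value t P : 'rV[int]_d := \row_i value (P i) t.

Definition point_expr P : nat -> expr k := fun i =>
  match i with
  | 0 => EConst 1
  | 1 => EConst 0
  | j.+2 => if insub j is Some j then P j else EConst 0
  end.

Definition eq_expr P Q : expr k :=
  all_expr [seq zero_expr (EOp Defs.Sub (P i) (Q i)) | i <- enum 'I_d].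

(** Distinct expressions may give the same point at some [t], so a point is counted only at its last
    occurrence, in agreement with [undup]. *)
Fixpoint count_expr (phi : formula k) (L : seq ('I_d -> expr k)) : expr k :=
  if L is P :: L' then
    EOp Add (EOp Mul (all_expr [seq not_expr (eq_expr P Q) | Q <- L'])
                     (sat_expr d.+2 (point_expr P) phi)) (count_expr phi L')
  else EConst 0.

Lemma value_eq P Q t :
  value (eq_expr P Q) t = (point_value t P == point_value t Q)%:Z.
Proof.
rewrite (@value_all _ _ _ _ (fun i => value (P i) t == value (Q i) t)); last first.
  by move=> i; rewrite value_zero /= subr_eq0.
congr (nat_of_bool _)%:Z; apply/allP/eqP => [H|/rowP H i _].
  by apply/rowP => i; rewrite !mxE; apply/eqP/H; rewrite mem_enum.
by have := H i; rewrite !mxE => ->.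
Qed.

Lemma value_count phi L t : value (count_expr phi L) t =
  (count (fun x => sat d.+2 t (point_env 0 x) phi)
     (undup [seq point_value t P | P <- L]))%:Z.
Proof.
elim: L => //= P L ->; rewrite value_sat.
rewrite (@value_all _ _ _ _ (fun Q => point_value t P != point_value t Q)); last first.
  by move=> Q; apply/value_not/value_eq.
have -> : all (fun Q => point_value t P != point_value t Q) L =
    (point_value t P \notin [seq point_value t Q | Q <- L]).
  by elim: L => //= Q L ->; rewrite inE negb_or.
rewrite (sat_ext _ _ (w := point_env 0 (point_value t P))) => [|[|[|j]] //]; last first.
  by rewrite !ltnS => jd; rewrite /= insubT mxE.
case: (_ \in _); first by rewrite mul0r add0r.
by rewrite mul1r /= PoszD.
Qed.

(** Indices past the end of [C i] read the default 0. The resulting extra points are harmless, as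
    every grid point is tested for membership when counting. *)
Definition grid (C : 'I_d -> seq (expr k)) : seq ('I_d -> expr k) :=
  [seq (fun i => nth (EConst 0) (C i) (f i)) |
     f : {ffun 'I_d -> 'I_(\max_i size (C i)).+1}].

Lemma mem_grid C t (x : 'rV[int]_d) :
  (forall i, x 0 i \in [seq value a t | a <- C i]) ->
  x \in [seq point_value t P | P <- grid C].
Proof.
move=> xC; set M := \max_i size (C i).
have lt i : (index (x 0%R i) [seq value a t | a <- C i] < M.+1)%N.
  rewrite ltnS (leq_trans (index_size _ _)) // size_map.
  exact: (leq_bigmax (F := fun i => size (C i))).
rewrite -map_comp; apply/mapP.
exists [ffun i => Ordinal (lt i)]; first by rewrite mem_enum.
apply/rowP => i; rewrite mxE ffunE /=.
rewrite -(nth_map (EConst 0) 0 (fun a => value a t)).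
  by rewrite nth_index.
by rewrite -(size_map (fun a => value a t)) index_mem.
Qed.

End Counting.

(** * Assembly: nonemptiness, finiteness and the cardinality *)

Theorem theorem4p2 (k d : nat) (F : unordered_family k d) :
  [/\ polytime_decidable (fun t : 'rV[int]_k => member F t !=set0),
      polytime_decidable (fun t : 'rV[int]_k => finite_set (member F t)) &
      exists g : 'rV[int]_k -> nat,
        polytime_computable (fun t : 'rV[int]_k => (g t)%:Z) /\
        forall t : 'rV[int]_k,
          finite_set (member F t) -> member F t #= `I_(g t)].
Proof.
have [phi phiP] := member_formula F.
have decide n (psi : formula k) (P : 'rV[int]_k -> Prop) :
    (forall t, sat n t (line 0) psi <-> P t) -> polytime_decidable P.
  move=> H; exists (fun t => sat n t (line 0) psi); split=> //.
  apply: polytime_eq (polytime_value (sat_expr n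
    (fun i => if i is 0 then EConst 1 else EConst 0) psi)) => t.
  by rewrite value_sat; congr (nat_of_bool _)%:Z; apply: sat_ext => -[].
(* [psi i] defines the projection of S_t to coordinate [i], and [chi i] below states that its
   periodic part is nonempty. *)
have [psi psiP] := fin_all_exists (@projection_formula k d phi).
have [chi chiP] := fin_all_exists (fun i =>
  @eliminate_exists k 1 (periodic_part (psi i)) isT).
have chi_line t i : sat 1 t (line 0) (chi i) <->
    exists p, sat 2 t (line p) (periodic_part (psi i)).
  apply: iff_trans (chiP i t _ erefl) _.
  have E p : sat 2 t (set_var (line 0) 1 p) (periodic_part (psi i)) =
    sat 2 t (line p) (periodic_part (psi i)) by apply: sat_ext => -[|[|]].
  by split=> -[p Hp]; exists p; move: Hp; rewrite E.
(* The finiteness criterion: under it every coordinate of a member is exceptional, which confines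
   S_t to the grid [L]. *)
pose nonperiodic t := forall i : 'I_d, ~~ sat 1 t (line 0) (chi i).
pose L := grid (fun i => [seq solution_expr a | a <- atoms (psi i)]).
have in_grid t x : nonperiodic t -> member F t x ->
    x \in [seq point_value t P | P <- L].
  move=> np Fx; apply: mem_grid => i; rewrite -map_comp.
  apply: contraT => nex; have /negP[] := np i; apply/chi_line.
  exists (x 0 i); rewrite sat_periodic_part //.
  by apply/psiP; exists x; split=> //; apply/phiP.
pose u t := [seq x <- undup [seq point_value t P | P <- L]
            | sat d.+2 t (point_env 0 x) phi].
have memberE t : nonperiodic t -> member F t = [set` u t].
  move=> np; apply/seteqP; split=> x /=; rewrite mem_filter mem_undup.
    by move=> Fx; rewrite in_grid // andbT; apply/phiP.
  by move=> /andP[/phiP].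
(* A finite S_t has finite projections, whose periodic parts are empty by [finite_line]; conversely
   S_t is listed by [u t]. *)
have finiteP t : finite_set (member F t) <-> nonperiodic t.
  split=> [/finite_seqP[s sE] i|np]; last by rewrite memberE.
  apply/negP => /chi_line[p]; apply/negP.
  have fin q : sat 2 t (line q) (psi i) -> q \in [seq x 0 i | x : 'rV[int]_d <- s].
    move=> /psiP[x [/phiP Fx <-]].
    by apply: map_f; have : [set` s] x by rewrite -sE.
  exact: finite_line fin.
split.
- have [theta thetaP] := eliminate_point d phi.
  apply: (decide 2%N theta) => t; apply: iff_trans (thetaP t 0) _.
  by split=> -[x /phiP]; exists x.
- apply: (decide 1%N (FAll [seq FNot (chi i) | i <- enum 'I_d])) => t.
  rewrite sat_FAll all_map; apply: iff_trans (iff_sym (finiteP t)).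
  split=> [/allP H i|H]; first by apply: H; rewrite mem_enum.
  by apply/allP => i _; apply: H.
(* For infinite S_t this still counts the members on the grid, so the same expression computes it
   for every [t]. *)
exists (fun t => size (u t)); split=> [|t /finiteP np].
  apply: polytime_eq (polytime_value (count_expr phi L)) => t.
  by rewrite value_count size_filter.
rewrite memberE // (_ : [set` u t] = [set` [fset x in u t]%fset]).
  apply/card_eq_fsetP; rewrite card_fseq undup_id //.
  by rewrite filter_uniq ?undup_uniq.
by apply/seteqP; split=> x /=; rewrite inE.
Qed.
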